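(* Let $m\in\mathbb{N}$. For every $f\in\mathcal{C}(\mathbb{R}^m)$ with $f\ge 0$ there is an increasing sequence in $\mathrm{vlt}(\mathrm{Aff}(\mathbb{R}^m))\cap\mathcal{C}_{00}(\mathbb{R}^m)\cap[\mathbf{0},f]$ which is relatively uniformly convergent to $f$ in $\mathcal{C}(\mathbb{R}^m)$.
   Context: $\mathcal{C}(\mathbb{R}^m)$ is the vector lattice of continuous real-valued functions on $\mathbb{R}^m$ with pointwise order; $\mathcal{C}_{00}(\mathbb{R}^m)$ is the set of those that vanish outside of a compact set. $\mathrm{Aff}(\mathbb{R}^m)$ is the set of affine functions $\mathbb{R}^m\to\mathbb{R}$. For a subset $A$ of a vector lattice, $\mathrm{vlt}(A)$ is the linear sublattice generated by $A$ (the smallest linear subspace containing $A$ and closed under the lattice operations). $\mathbf{0}$ is the zero function and $[\mathbf{0},f]=\{g: \mathbf{0}\le g\le f\}$. ''Increasing'' means $g_n\le g_{n+1}$ for all $n$. A sequence $(f_n)$ in a vector lattice $G$ converges relatively uniformly to $f$ if there is $e\in G_+$ such that $f$ lies in the principal ideal $G_e=\{g: |g|\le\alpha e\text{ for some }\alpha\ge0\}$ and for every $\varepsilon>0$ there is $n_0$ with $|f-f_n|\le\varepsilon e$ for all $n\ge n_0$. *)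

(* Defs.v *)
From HB Require Import structures.
From mathcomp Require Import all_boot all_order all_algebra.
From mathcomp Require Import all_classical all_reals all_analysis.

Set Implicit Arguments.
Unset Strict Implicit.
Unset Printing Implicit Defensive.

Import Order.TTheory GRing.Theory Num.Theory.
Import numFieldNormedType.Exports.

Local Open Scope classical_set_scope.
Local Open Scope ring_scope.

(* In this file (_ <= _)%O, Order.join and Order.meet between functions T -> R
   are the pointwise order and lattice operations (see boolp); vector lattices
   are represented as linear sublattices of T -> R. *)

Definition absf (R : realType) (T : Type) (g : T -> R) : T -> R :=
  Order.join g (- g).

Definition linear_sublattice (R : realType) (T : Type) (L : set (T -> R)) :=
  [/\ L 0,
      forall (a : R) f g, L f -> L g -> L (a *: f + g),
      forall f g, L f -> L g -> L (Order.join f g) &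
      forall f g, L f -> L g -> L (Order.meet f g)].

(* The generated sublattice is taken in the full function lattice T -> R; it is
   the same in every linear sublattice of T -> R that contains A. *)
Definition vlt (R : realType) (T : Type) (A : set (T -> R)) : set (T -> R) :=
  smallest (@linear_sublattice R T) A.

Definition Cfun (R : realType) (m : nat) : set ('rV[R]_m -> R) :=
  [set f | continuous f].

Definition C00 (R : realType) (m : nat) : set ('rV[R]_m -> R) :=
  [set f | continuous f /\
     exists K : set 'rV[R]_m, compact K /\ forall x, ~ K x -> f x = 0].

Definition Aff (R : realType) (m : nat) : set ('rV[R]_m -> R) :=
  [set f | exists (l : {scalar 'rV[R]_m}) (c : R), forall x, f x = l x + c].

Definition order_segment (R : realType) (T : Type) (f g : T -> R) :
    set (T -> R) :=
  [set h | (f <= h)%O /\ (h <= g)%O].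

Definition increasing (R : realType) (T : Type) (u : nat -> T -> R) :=
  forall n, (u n <= u n.+1)%O.

Definition principal_ideal (R : realType) (T : Type) (G : set (T -> R))
    (e : T -> R) : set (T -> R) :=
  [set g | G g /\ exists2 a : R, 0 <= a & (absf g <= a *: e)%O].

Definition ru_convergent (R : realType) (T : Type) (G : set (T -> R))
    (u : nat -> T -> R) (f : T -> R) :=
  (forall n, G (u n)) /\
  exists e : T -> R,
    [/\ G e, ((0 : T -> R) <= e)%O, principal_ideal G e f &
        forall eps : R, 0 < eps ->
          exists n0 : nat, forall n : nat, (n0 <= n)%N ->
            (absf (f - u n) <= eps *: e)%O].

(* Main.v *)
(** Write [S] for the set of admissible minorants of [f] (piecewise affine, of
compact support, between [0] and [f]); it is closed under finite suprema. At a
given point [y], the cone [max(0, f y - eps - (f y / r) |x - y|)] with [r] small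
is in [S] and almost attains [f y]. A Dini argument on the directed set [S]
upgrades this to: on every compact set some [g] in [S] satisfies
[f < g + eps]. Taking [g n] for the ball of radius [n] and [eps = 1/(n+1)], the
sequence [u n = g 0 \/ ... \/ g n] converges relatively uniformly to [f] with
regulator [e x = 1 + (1 + |x|) f x]: inside the ball the error is at most
[1/(n+1)], and outside it is at most [f x <= (1 + |x|) f x / (n+1)]. *)

Require Import Defs.
From HB Require Import structures.
From mathcomp Require Import all_boot all_order all_algebra.
From mathcomp Require Import all_classical all_reals all_analysis.
From mathcomp Require Import lra.

Import Order.TTheory GRing.Theory Num.Theory.
Import numFieldNormedType.Exports.

Local Open Scope classical_set_scope.
Local Open Scope ring_scope.

(** Each closure condition is stable under intersections of sublattices. *)
Lemma linear_sublattice_vlt {R : realType} {T : Type} (A : set (T -> R)) :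
  linear_sublattice (vlt A).
Proof.
split.
- by move=> L [[L0 _ _ _] _].
- move=> a f g vf vg L LA; have [[_ LZD _ _] _] := LA.
  by apply: LZD; [exact: vf | exact: vg].
- move=> f g vf vg L LA; have [[_ _ LU _] _] := LA.
  by apply: LU; [exact: vf | exact: vg].
- move=> f g vf vg L LA; have [[_ _ _ LI] _] := LA.
  by apply: LI; [exact: vf | exact: vg].
Qed.

Section linear_sublattice_theory.
Context {R : realType} {T : Type} {L : set (T -> R)}.
Hypothesis L_lattice : linear_sublattice L.

Lemma linear_sublattice_scale (a : R) f : L f -> L (a *: f).
Proof.
by have [L0 LZD _ _] := L_lattice => Lf; rewrite -[_ *: _]addr0; exact: LZD.
Qed.

Lemma linear_sublattice_add f g : L f -> L g -> L (f + g).
Proof.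
by have [_ LZD _ _] := L_lattice => Lf Lg; rewrite -[f]scale1r; exact: LZD.
Qed.

Lemma linear_sublattice_join f g : L f -> L g -> L (Order.join f g).
Proof. by have [_ _ + _] := L_lattice; apply. Qed.

Lemma linear_sublattice_abs f : L f -> L (absf f).
Proof.
move=> Lf; apply: linear_sublattice_join => //.
by rewrite -scaleN1r; exact: linear_sublattice_scale.
Qed.

Lemma linear_sublattice_bigjoin (I : Type) (s : seq I) (F : I -> T -> R) :
  (forall i, L (F i)) -> L (\big[Order.join/0]_(i <- s) F i).
Proof.
move=> LF; have [L0 _ _ _] := L_lattice.
by elim/big_ind : _ => // f g; exact: linear_sublattice_join.
Qed.

End linear_sublattice_theory.

Lemma bigjoin_funE (R : realType) (T I : Type) (s : seq I) (F : I -> T -> R) x :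
  (\big[Order.join/0]_(i <- s) F i) x = \big[Num.max/0]_(i <- s) F i x.
Proof.
elim/big_ind2 : _ => // f a g b fxa gxb.
by rewrite joinfE joinEtotal fxa gxb.
Qed.

Lemma absfE (R : realType) (T : Type) (f : T -> R) x : absf f x = `|f x|.
Proof. by rewrite /absf joinfE joinEtotal maxrN. Qed.

(** This is the common shape of the cone in [cone_minorant] and of the regulator [e] in the
    theorem. *)
Lemma continuous_addM (R : realType) (T : topologicalType) (a : R)
    (g h : T -> R) :
  continuous g -> continuous h -> continuous (fun x => a + g x * h x).
Proof.
move=> cg ch x; apply: cvgD; first exact: cvg_cst.
by apply: cvgM; [exact: cg | exact: ch].
Qed.

Section minorants.
Context {R : realType} {m : nat}.
Implicit Types (f g h : 'rV[R]_m -> R) (x y : 'rV[R]_m).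

Lemma vlt_Aff_cst (c : R) : vlt (@Aff R m) (fun=> c).
Proof.
apply: sub_gen_smallest; exists (\0%R : {scalar 'rV[R]_m}), c => x.
by rewrite add0r.
Qed.

(** The norm on row vectors is the maximum norm, so the distance to [y] is a finite join of absolute
    values of affine coordinate functions. The base value [0] of the join also covers [m = 0]. *)
Lemma vlt_Aff_dist y : vlt (@Aff R m) (fun x => `|x - y|).
Proof.
have vL := linear_sublattice_vlt (@Aff R m).
pose F (ij : 'I_1 * 'I_m) : 'rV[R]_m -> R :=
  absf (fun x => x ij.1 ij.2 - y ij.1 ij.2).
suff -> : (fun x => `|x - y|) = \big[Order.join/0]_ij F ij.
  apply: (linear_sublattice_bigjoin vL) => -[i j].
  apply: (linear_sublattice_abs vL); apply: sub_gen_smallest => /=.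
  pose l x : R^o := x i j.
  have l_linear : linear l by move=> a u v; rewrite /l !mxE.
  pose lM := GRing.isLinear.Build _ _ _ _ l l_linear.
  pose lL : {scalar 'rV[R]_m} := HB.pack l lM.
  by exists lL, (- y i j) => x.
apply/funext => x; rewrite bigjoin_funE /Num.norm /= mx_normrE.
by apply: eq_bigr => ij _; rewrite /F absfE !mxE.
Qed.

Definition minorants f : set ('rV[R]_m -> R) :=
  vlt (@Aff R m) `&` @C00 R m `&` order_segment 0 f.

Lemma continuous_join f g :
  continuous f -> continuous g -> continuous (Order.join f g).
Proof.
move=> cf cg x; rewrite (_ : Order.join f g = f \max g)%O.
  by apply: continuous_max; [exact: cf | exact: cg].
by apply/funext => y; rewrite joinfE joinEtotal.
Qed.

Lemma minorants0 f : ((0 : 'rV[R]_m -> R) <= f)%O -> minorants f 0.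
Proof.
move=> f0; split; last by split.
split; first exact: vlt_Aff_cst.
split; first exact: cst_continuous.
by exists set0; split => //; exact: compact0.
Qed.

Lemma minorants_join f g h :
  minorants f g -> minorants f h -> minorants f (Order.join g h).
Proof.
move=> [[vg [cg [K [cK Kg]]]] [g0 gf]] [[vh [ch [K' [cK' Kh]]]] [h0 hf]].
split; last by split; [exact: le_trans (leUl _ _) | rewrite leUx gf].
split; first exact: linear_sublattice_join (linear_sublattice_vlt _) _ _ _ _.
split; first exact: continuous_join.
exists (K `|` K'); split; first exact: compactU.
move=> x KK'x; rewrite joinfE Kg ?Kh ?joinxx//.
- by move=> K'x; apply: KK'x; right.
- by move=> Kx; apply: KK'x; left.
Qed.

Lemma continuous_dist y : continuous (fun x => `|x - y|).
Proof.
move=> x; apply: continuous_comp; last exact: norm_continuous.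
by apply: continuousB; [exact: cvg_id | exact: cst_continuous].
Qed.

Lemma compact_closed_ball_rV x (r : R) : compact [set y | `|y - x| <= r].
Proof.
apply: bounded_closed_compact.
  exists (r + `|x|); split; first exact: num_real.
  move=> M rM y /= yxr; rewrite -(subrK x y).
  by rewrite (le_trans (ler_normD _ _))// (le_trans _ (ltW rM))// lerD2r.
apply: (@closed_comp _ _ (fun y => `|y - x|) [set t | t <= r]).
  move=> y _; exact: continuous_dist.
exact: closed_le.
Qed.

Lemma cone_minorant f y (eps : R) :
  continuous f -> ((0 : 'rV[R]_m -> R) <= f)%O -> 0 < eps ->
  exists2 g, minorants f g & f y - eps <= g y.
Proof.
move=> cf /lefP f_ge0 eps0; have {}f_ge0 x : 0 <= f x by exact: f_ge0.
have /nbhs_ballP[r /= r0 fr] : \forall x \near y, `|f y - f x| < eps.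
  by have /cvgrPdist_lt := cf y; exact.
(* With slope [f y / r] the cone has dropped to at most [- eps] at distance [r], so its positive
   part lives in the ball where [f] stays above [f y - eps]. *)
pose cone x := f y - eps + - (f y / r) * `|x - y|.
have cone_out x : r <= `|x - y| -> cone x < 0.
  move=> rx; rewrite /cone.
  have : f y <= f y / r * `|x - y|.
    by rewrite mulrAC ler_pdivlMr// ler_wpM2l// f_ge0.
  lra.
have vcone : vlt (@Aff R m) cone.
  have vL := linear_sublattice_vlt (@Aff R m).
  rewrite (_ : cone = (fun=> f y - eps) + (- (f y / r)) *: (fun x => `|x - y|)).
    apply: (linear_sublattice_add vL); first exact: vlt_Aff_cst.
    by apply: (linear_sublattice_scale vL); exact: vlt_Aff_dist.
  by [].
have ccone : continuous cone.
  apply: continuous_addM; first exact: cst_continuous.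
  exact: continuous_dist.
exists (Order.join (0 : 'rV[R]_m -> R) cone); last first.
  by rewrite joinfE joinEtotal /cone subrr normr0 mulr0 addr0 le_max lexx orbT.
split; last first.
  split; first exact: leUl.
  rewrite leUx; apply/andP; split; apply/lefP => x; first exact: f_ge0.
  (* Away from [y] the cone is negative, hence below [f]. Near [y] it is at most its apex value
     [f y - eps], which is less than [f x]. *)
  have [/cone_out/ltW|xr] := leP r `|x - y|.
    by move=> /le_trans; apply; exact: f_ge0.
  have := fr x; rewrite -ball_normE /= distrC => /(_ xr) /ltr_normlP[_].
  have : 0 <= f y / r * `|x - y| by rewrite mulr_ge0 ?divr_ge0 ?f_ge0// ltW.
  rewrite /cone; lra.
split.
  apply: (linear_sublattice_join (linear_sublattice_vlt _)) => //.
  exact: vlt_Aff_cst.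
split; first by apply: continuous_join => //; exact: cst_continuous.
exists [set x | `|x - y| <= r]; split; first exact: compact_closed_ball_rV.
move=> x /= /negP; rewrite -ltNge => /ltW/cone_out x0.
by rewrite joinfE joinEtotal max_l// ltW.
Qed.

(* Dini: the minorants of [f] form a directed set, and compactness in its
   near-covering form applies to the filter of its upper sections. *)
Lemma minorant_compact f (K : set 'rV[R]_m) (eps : R) :
  continuous f -> ((0 : 'rV[R]_m -> R) <= f)%O -> compact K -> 0 < eps ->
  exists2 g, minorants f g & forall x, K x -> f x < g x + eps.
Proof.
move=> cf f0 cK eps0.
pose above g : set ('rV[R]_m -> R) := [set h | (g <= h)%O].
(* A property holds eventually along [F] when all functions above some minorant have it. *)
pose F := filter_from (minorants f) above.
have FF : Filter F.
  apply: filter_from_filter; first by exists 0; exact: minorants0.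
  move=> g h fg fh; exists (Order.join g h); first exact: minorants_join.
  by move=> k /=; rewrite /above /= leUx => /andP[].
have [g fg gK] : F [set h | K `<=` [set x | f x < h x + eps]].
  have /compact_near_coveringP cover := cK.
  apply: (cover _ F (fun h x => f x < h x + eps) FF) => y _.
  (* Losing only [eps / 2] at [y] makes [f - g < eps] strict there, so it persists on a
     neighbourhood by continuity, and for every [h] above [g]. *)
  have eps2 : 0 < eps / 2 by lra.
  have [g fg fgy] := cone_minorant f y _ cf f0 eps2.
  have cfg : {for y, continuous (f - g)}.
    by have [[_ [cg _]] _] := fg; apply: continuousB; [exact: cf | exact: cg].
  exists ([set x | f x < g x + eps], above g) => /=.
    split; last by exists g.
    have fgy_lt : (f - g) y < eps by rewrite !fctE; move: eps0 fgy; lra.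
    have := cfg _ (lt_nbhsl fgy_lt).
    by apply: (@filterS _ _ (nbhs_filter y)) => x; rewrite !fctE/= ltrBlDl.
  move=> [x h] /= [fgx /lefP gh].
  by rewrite (lt_le_trans fgx)// lerD2r.
by exists g => //; exact: (gK g (lexx _)).
Qed.

End minorants.

Theorem corollary3p9 (R : realType) (m : nat) (f : 'rV[R]_m -> R) :
  @Cfun R m f -> ((0 : 'rV[R]_m -> R) <= f)%O ->
  exists u : nat -> 'rV[R]_m -> R,
    [/\ increasing u,
        forall n, (vlt (@Aff R m) `&` @C00 R m `&` order_segment 0 f) (u n) &
        ru_convergent (@Cfun R m) u f].
Proof.
move=> cf f0.
have f_ge0 x : 0 <= f x by move/lefP : f0; apply.
have /choice[g gP] n : exists g, minorants f g /\
    forall x, `|x| <= n%:R -> f x < g x + n.+1%:R^-1.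
  have [||g fg fgn] :=
      minorant_compact f [set x | `|x - 0| <= n%:R] n.+1%:R^-1 cf f0.
  - exact: compact_closed_ball_rV.
  - by rewrite invr_gt0.
  by exists g; split=> // x xn; apply: fgn; rewrite /= subr0.
(* The [g n] need not be monotone; their running joins are, and stay minorants. *)
pose u := fix u n := if n is k.+1 then Order.join (u k) (g n) else g 0%N.
have fu n : minorants f (u n).
  elim: n => [|n IHn]; first by have [] := gP 0%N.
  by apply: minorants_join => //; have [] := gP n.+1.
have gu n : (g n <= u n)%O by case: n => [|n]; [exact: lexx | exact: leUr].
pose e x := 1 + (1 + `|x|) * f x.
have e_ge x : 1 <= e x /\ (1 + `|x|) * f x <= e x.
  by rewrite /e lerDl lerDr ler01 mulr_ge0 ?addr_ge0.
exists u; split => [n|//|]; first exact: leUl.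
split=> [n|]; first by have [[_ []]] := fu n.
exists e; split.
- apply: continuous_addM => //.
  under eq_fun do rewrite -[`|_|]mul1r.
  by apply: continuous_addM; [exact: cst_continuous | exact: norm_continuous].
- by apply/lefP => x; rewrite (le_trans ler01)//; have [] := e_ge x.
- split=> //; exists 1 => //; apply/lefP => x.
  rewrite absfE scale1r ger0_norm//; have [_] := e_ge x.
  by apply: le_trans; rewrite ler_peMl// lerDl.
- move=> eps eps0.
  have [n0 _ n0P] := near_infty_natSinv_lt (PosNum eps0).
  exists n0 => n n0n; apply/lefP => x.
  have [_ [/lefP/(_ x) u0 /lefP/(_ x) uf]] := fu n.
  rewrite absfE !fctE ger0_norm ?subr_ge0//.
  have neps : n.+1%:R^-1 < eps by exact: n0P.
  have [e1 e2] := e_ge x.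
  (* Both cases below bound the error by [e x / (n + 1)]: inside the ball through [1 <= e x],
     outside through the other summand of [e]. *)
  apply: (@le_trans _ _ (n.+1%:R^-1 * e x)); last first.
    by rewrite ler_wpM2r ?(le_trans ler01)// ltW.
  have [xn|nx] := leP `|x| n%:R.
    apply: (@le_trans _ _ n.+1%:R^-1); last by rewrite ler_peMr// invr_ge0.
    have [_ /(_ x xn) fxg] := gP n; move/lefP/(_ x) : (gu n) => gun.
    by rewrite lerBlDr addrC (le_trans (ltW fxg))// lerD2r.
  (* Nothing is known of [u n] here beyond [0 <= u n], but [n + 1 <= 1 + |x|] gives
     [(n + 1) * f x <= e x]. *)
  apply: (@le_trans _ _ (f x)); first by rewrite gerBl.
  rewrite ler_pdivlMl// (le_trans _ e2)// ler_wpM2r//.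
  by rewrite -natr1 addrC lerD2l ltW.
Qed.
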